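(* Let $\mathcal{D}$ be a finite strongly connected digraph with Hashimoto matrix $H$, let $p\in[0,1]$ satisfy $p\|H\|_1<1$, and consider site percolation on $\mathcal{D}$ with parameter $p$. Then for every integer $m>0$ and every vertex $v$ of $\mathcal{D}$, the probability $P_m^{(\mathrm{out})}(v)$ that $v$ is the root of an out-component of size $m$ or greater satisfies $$m\,P_m^{(\mathrm{out})}(v)\le \frac{1}{1-p\|H\|_1}.$$
   Context: A digraph $\mathcal{D}$ has a finite vertex set $\mathcal{V}(\mathcal{D})$ and an edge set $\mathcal{E}(\mathcal{D})$ of ordered pairs $i\to j$ of distinct vertices; it may contain symmetric edges, i.e. both $i\to j$ and $j\to i$. It is strongly connected if every vertex can be reached from every other vertex by a directed walk. The Hashimoto (non-backtracking) matrix $H$ is the square $0/1$ matrix with rows and columns indexed by $\mathcal{E}(\mathcal{D})$, with the following convention: for $u=i\to j$ and $v=j'\to l$ in $\mathcal{E}(\mathcal{D})$, $H_{v,u}=\delta_{jj'}(1-\delta_{li})$. That is, $H_{v,u}=1$ exactly when the edge $v$ can directly follow the edge $u$ in a non-backtracking directed walk. $\|H\|_1$ is the matrix norm induced by the vector $1$-norm, $\|H\|_1=\max_u\sum_v|H_{v,u}|$ (maximum column sum). Site percolation with parameter $p$: each vertex of $\mathcal{D}$ is independently open with probability $p$ and closed with probability $1-p$, and $\mathcal{D}'$ is the subgraph of $\mathcal{D}$ induced by the open vertices. A vertex $v$ is the root of an out-component of size $m$ or greater if $v\in\mathcal{V}(\mathcal{D}')$ and at least $m-1$ vertices other than $v$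 can be reached by directed walks on $\mathcal{D}'$ starting at $v$.
   Formalization: The digraph is assumed not to have exactly two vertices: for two vertices joined by symmetric edges, H = 0, and with p = 1, m = 2 the claimed bound would read 2 ≤ 1, so the statement fails there. *)

(* Defs.v *)
From HB Require Import structures.
From mathcomp Require Import all_boot all_order all_algebra.
From mathcomp Require Import reals.

Set Implicit Arguments.
Unset Strict Implicit.
Unset Printing Implicit Defensive.

Import Order.TTheory GRing.Theory Num.Theory.
Local Open Scope ring_scope.

(* A digraph is a finite vertex type [V] with an irreflexive relation [e];    *)
(* [e] need not be symmetric, but may contain both [e i j] and [e j i].       *)

Definition strongly_connected (V : finType) (e : rel V) : Prop :=
  forall x y : V, connect e x y.

Definition edge (V : finType) (e : rel V) : finType :=
  {a : V * V | e a.1 a.2}.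

Definition edge_src (V : finType) (e : rel V) (a : edge e) : V := (val a).1.
Definition edge_tgt (V : finType) (e : rel V) (a : edge e) : V := (val a).2.

(* Rows and columns are numbered by the enumeration of the edges; the column  *)
(* index is the earlier edge and the row index the edge that follows it.      *)
Definition hashimoto (R : realType) (V : finType) (e : rel V)
    : 'M[R]_#|edge e| :=
  \matrix_(b, a)
    let v := enum_val b in let u := enum_val a in
    (edge_tgt u == edge_src v)%:R * (1 - (edge_tgt v == edge_src u)%:R).

(* Since column sums are nonnegative, starting the maximum at 0 only matters  *)
(* for the matrix without columns, whose norm is 0.                           *)
Definition norm1_mx (R : realType) (n : nat) (A : 'M[R]_n) : R :=
  \big[Num.max/0]_(u < n) \sum_(v < n) `|A v u|.

Definition site_prob (R : realType) (V : finType) (p : R)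
    (E : pred {set V}) : R :=
  \sum_(S : {set V} | E S) \prod_(x : V) (if x \in S then p else 1 - p).

Definition induced (V : finType) (e : rel V) (S : {set V}) : rel V :=
  [rel x y | [&& x \in S, y \in S & e x y]].

Definition out_root (V : finType) (e : rel V) (m : nat) (v : V)
    (S : {set V}) : bool :=
  (v \in S) && (m.-1 <= #|[set w | (w != v) && connect (induced e S) v w]|)%N.

Definition P_out (R : realType) (V : finType) (e : rel V) (p : R)
    (m : nat) (v : V) : R :=
  site_prob p (out_root e m v).

(* Main.v *)
Require Import Defs.
From HB Require Import structures.
From mathcomp Require Import all_boot all_order all_algebra.
From mathcomp Require Import reals.
From mathcomp Require Import ring lra.
Import Order.TTheory GRing.Theory Num.Theory.
Local Open Scope ring_scope.

Set Implicit Arguments.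
Unset Strict Implicit.
Unset Printing Implicit Defensive.

(* A vertex reached from v is the end of an open self-avoiding, hence
   non-backtracking, walk.  Let h = ||H||_1 and let d be the out-degree of v.
   Markov's inequality for the size of the out-component gives
   m P <= p + p^2 d / (1 - p h), and since v has an incoming edge, d <= h + 1.
   This suffices unless d = h + 1 with h <= 1: for h >= 2 one has p < 1/2, and
   h = 0 forces a two-vertex digraph.  If h = 1 and d = 2, the first moment is
   too large for p near 1, but non-backtracking walks from v are confined to two
   rays.  Exposing the first ray up to its first closed vertex and then the
   second one yields P <= p^m (1 + (m - 1) (1 - p)), and
   m (1 - p) p^m (1 + (m - 1) (1 - p)) <= 1 by comparison with the negative
   binomial expansion of (1 - q)^(-m) at q = 1 - p. *)

(** * Polynomial inequalities from the negative binomial series *)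

(** The bracket [T_m] is the cubic truncation of the series of (1 - q)^(-m). Multiplying [T_(m+1)]
    by 1 - q gives [T_m] up to the boundary term - C(m+3, 3) q^4, so the left side decreases in
    [m]. *)
Lemma negative_binomial_le1 (R : realFieldType) (q : R) (m : nat) :
  0 <= q -> q <= 1 ->
  (1 - q) ^+ m *
    (1 + m%:R * q + m%:R * (m%:R + 1) / 2 * q ^+ 2
       + m%:R * (m%:R + 1) * (m%:R + 2) / 6 * q ^+ 3) <= 1.
Proof.
move=> q0 q1; elim: m => [|m IHm]; first by rewrite expr0; lra.
apply: le_trans IHm; rewrite exprSr -mulrA ler_wpM2l ?exprn_ge0 ?subr_ge0 //.
rewrite -natr1; set x := m%:R.
have x0 : 0 <= x by apply: ler0n.
rewrite -subr_ge0.
have -> : 1 + x * q + x * (x + 1) / 2 * q ^+ 2 +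
    x * (x + 1) * (x + 2) / 6 * q ^+ 3 -
   (1 - q) *
     (1 + (x + 1) * q + (x + 1) * (x + 1 + 1) / 2 * q ^+ 2 +
      (x + 1) * (x + 1 + 1) * (x + 1 + 2) / 6 * q ^+ 3) =
   (x + 1) * (x + 2) * (x + 3) / 6 * q ^+ 4 by field.
by rewrite !mulr_ge0 ?exprn_ge0 ?invr_ge0 ?addr_ge0 ?ler0n.
Qed.

Lemma two_run_tail_le1 (R : realFieldType) (p : R) (m : nat) :
  0 <= p -> p <= 1 ->
  m%:R * (1 - p) * (p ^+ m * (1 + (m.-1)%:R * (1 - p))) <= 1.
Proof.
move=> p0 p1; case: m => [|m] /=; first by rewrite !mul0r.
have q0 : 0 <= 1 - p by lra.
have q1 : 1 - p <= 1 by lra.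
apply: le_trans (negative_binomial_le1 m.+1 q0 q1).
rewrite [1 - (1 - p)]subKr mulrCA ler_wpM2l ?exprn_ge0 //.
rewrite -natr1; move: (m%:R) (ler0n R m) (1 - p) q0 => x x0 q q0.
have y0 : 0 <= x * q by rewrite mulr_ge0.
set y := x * q in y0.
(* Here x = m - 1 in terms of the original [m]. The part in [y] alone is 1 - y^2/2 + y^3/6, with
   minimum 1/3 at y = 2 over y >= 0. The cubic term of the truncation is what offsets - y^2/2. *)
rewrite -subr_ge0 [leRHS](_ : _ = (y - 2) ^+ 2 * (y + 1) / 6 + 1 / 3 +
    y * q / 2 + q ^+ 2 + y ^+ 2 * q + 11 / 6 * (y * q ^+ 2) + q ^+ 3); last first.
  by rewrite /y; field.
have c0 : 0 <= (y - 2) ^+ 2 * (y + 1) := mulr_ge0 (sqr_ge0 _) (addr_ge0 y0 ler01).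
have yq0 : 0 <= y * q := mulr_ge0 y0 q0.
have y2q0 : 0 <= y ^+ 2 * q := mulr_ge0 (sqr_ge0 _) q0.
have yq20 : 0 <= y * q ^+ 2 := mulr_ge0 y0 (sqr_ge0 _).
have q20 := sqr_ge0 q; have q30 := exprn_ge0 3 q0.
lra.
Qed.

(** * Site percolation: cylinder events and exploration of runs *)

Section Site.
Variables (R : realType) (V : finType) (p : R).
Hypotheses (p_ge0 : 0 <= p) (p_le1 : p <= 1).

Lemma site_weight_ge0 (S : {set V}) :
  0 <= \prod_(x : V) (if x \in S then p else 1 - p).
Proof. by apply: prodr_ge0 => x _; case: ifP; rewrite ?subr_ge0. Qed.

Lemma site_prob_le (E F : pred {set V}) :
  subpred E F -> site_prob p E <= site_prob p F.
Proof.
move=> EF; rewrite /site_prob [leRHS](bigID E) /=.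
rewrite [X in _ <= X + _](eq_bigl E) => [|S]; last first.
  by case ES: (E S) => /=; rewrite ?andbF ?andbT // (EF S ES).
by rewrite lerDl sumr_ge0 // => S _; apply: site_weight_ge0.
Qed.

Lemma site_prob_split (E F : pred {set V}) :
  site_prob p E = site_prob p (predI E F) + site_prob p (predD E F).
Proof.
rewrite /site_prob (bigID F) /=; congr (_ + _).
by apply: eq_bigl => S /=; rewrite andbC.
Qed.

(** A product over vertices of two-term sums, one term per state, expands into a sum over all [S].
    Zeroing the forbidden state on [A] and on [C] kills exactly the configurations outside the
    cylinder, and free vertices contribute p + (1 - p) = 1. *)
Lemma site_prob_cylinder (A C : {set V}) : [disjoint A & C] ->
  site_prob p (fun S => (A \subset S) && [disjoint C & S]) =
  p ^+ #|A| * (1 - p) ^+ #|C|.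
Proof.
move=> dAC.
have -> : p ^+ #|A| * (1 - p) ^+ #|C| =
    \prod_(x : V) ((if x \in C then 0 else p) + (if x \in A then 0 else 1 - p)).
  rewrite -!prodr_const (bigID (mem A) predT) /=; congr (_ * _).
    apply: eq_bigr => x xA; by rewrite xA addr0 (disjointFr dAC xA).
  rewrite [RHS](bigID (mem C)) /= [X in _ * X]big1 ?mulr1.
    apply: eq_big => x; last by move=> xC; rewrite xC (disjointFl dAC xC) add0r.
    by case: (boolP (x \in C)) => xC; rewrite ?andbF // (disjointFl dAC xC).
  by move=> x /andP[/negPf-> /negPf->]; rewrite addrC subrK.
rewrite bigA_distr /site_prob big_mkcond; apply: eq_bigr => S _.
case: ifP => [/andP[/subsetP AS dCS]|].
  apply: eq_bigr => x _; case: ifP => xS; first by rewrite (disjointFl dCS xS).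
  by case: ifP => // /AS; rewrite xS.
move/negbT; rewrite negb_and => /orP[/subsetPn[x xA xS]|].
  by rewrite (bigD1 x) //= (negPf xS) xA mul0r.
rewrite disjoint_subset => /subsetPn[x xC]; rewrite inE negbK => xS.
by rewrite (bigD1 x) //= xS xC mul0r.
Qed.

Lemma site_prob_subset (A : {set V}) :
  site_prob p (fun S => A \subset S) = p ^+ #|A|.
Proof.
rewrite -[RHS]mulr1 -(expr0 (1 - p)) -(cards0 V).
rewrite -site_prob_cylinder ?disjoints0 //; last by rewrite -setI_eq0 setI0.
by apply: eq_bigl => S; rewrite -[[disjoint _ & _]]setI_eq0 set0I eqxx andbT.
Qed.

Lemma markov_card (E : pred {set V}) (f : {set V} -> nat) m :
  (forall S, E S -> (m <= f S)%N) ->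
  m%:R * site_prob p E <=
  \sum_S (f S)%:R * \prod_(x : V) (if x \in S then p else 1 - p).
Proof.
move=> Ef; rewrite /site_prob big_distrr [leRHS](bigID E) /= -[leLHS]addr0.
apply: lerD; last first.
  by apply: sumr_ge0 => S _; rewrite mulr_ge0 ?ler0n ?site_weight_ge0.
by apply: ler_sum => S /Ef mf; rewrite ler_wpM2r ?site_weight_ge0 // ler_nat.
Qed.

Lemma site_prob_large_cylinder (n : nat) (A C : {set V}) (F : pred {set V}) :
  [disjoint A & C] -> (n <= #|A|)%N ->
  site_prob p (fun S => [&& A \subset S, [disjoint C & S] & F S]) <=
  p ^+ n * (1 - p) ^+ #|C|.
Proof.
move=> dAC nA; apply: (@le_trans _ _ (p ^+ #|A| * (1 - p) ^+ #|C|)).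
  rewrite -site_prob_cylinder //; apply: site_prob_le => S.
  by case/and3P=> -> ->.
by rewrite ler_wpM2r ?exprn_ge0 ?subr_ge0 // ler_wiXn2l.
Qed.

Fixpoint open_run (S : {set V}) (L : seq V) : seq V :=
  if L is x :: L' then if x \in S then x :: open_run S L' else [::] else [::].

Lemma open_run_prefix (S : {set V}) (s L : seq V) :
  prefix s L -> all (mem S) s -> {subset s <= open_run S L}.
Proof.
elim: s L => [|x s IHs] [|y L] //.
rewrite prefix_cons /= => /andP[/eqP<- sL] /andP[xS sS] z; rewrite xS !inE.
by case/orP=> [->//|/(IHs _ sL sS)->]; rewrite orbT.
Qed.

(** [A] and [C] hold the vertices already exposed as open and closed. While [A] has fewer than [n]
    elements, the next vertex of [L] must be open, so it joins [A]. Once [A] has [n] elements, the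
    cylinder bound applies. *)
Lemma site_prob_one_run (n : nat) (L : seq V) (A C : {set V}) :
  [disjoint A & C] ->
  site_prob p (fun S => [&& A \subset S, [disjoint C & S]
                          & (n <= #|A :|: [set x in open_run S L]|)%N]) <=
  p ^+ n * (1 - p) ^+ #|C|.
Proof.
have q_ge0 : 0 <= 1 - p by rewrite subr_ge0.
have setU_nil (B : {set V}) : B :|: [set x in [::]] = B.
  by apply/setP => x; rewrite !inE orbF.
elim: L A => [|b L IHL] A dAC; have [nA|An] := leqP n #|A|.
- exact: site_prob_large_cylinder.
- rewrite /site_prob big_pred0 ?mulr_ge0 ?exprn_ge0 // => S /=.
  by rewrite setU_nil leqNgt An !andbF.
- exact: site_prob_large_cylinder.
have [bA|bA] := boolP (b \in A).
  apply: le_trans (IHL A dAC); apply: site_prob_le => S /and3P[AS -> /=].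
  rewrite AS (subsetP AS _ bA) => /leq_trans-> //; apply/subset_leq_card/subsetP.
  by move=> x; rewrite !inE => /or3P[->//|/eqP->|->]; rewrite ?bA ?orbT.
have bS (S : {set V}) : (n <= #|A :|: [set x in open_run S (b :: L)]|)%N -> b \in S.
  by rewrite /=; case: ifP => // _; rewrite setU_nil leqNgt An.
have [bC|bC] := boolP (b \in C).
  rewrite /site_prob big_pred0 ?mulr_ge0 ?exprn_ge0 // => S.
  by apply/and3P => -[_ dCS /bS]; rewrite (disjointFr dCS bC).
apply: le_trans (IHL (b |: A) _); last first.
  by rewrite -setI_eq0 setIUl setU_eq0 !setI_eq0 disjoints1 bC dAC.
apply: site_prob_le => S /and3P[AS -> nS]; have bSS := bS _ nS.
rewrite subUset sub1set AS bSS /=; move: nS; rewrite /= bSS => /leq_trans-> //.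
apply/subset_leq_card/subsetP.
by move=> x; rewrite !inE -!orbA orbCA.
Qed.

(** The first run is blocked at one of at most n - #|A| new vertices, each costing p^n (1 - p) by
    the one-run bound for [L2]. The remaining case costs p^n. *)
Lemma site_prob_two_runs (n : nat) (L1 L2 : seq V) (A : {set V}) :
  site_prob p (fun S => (A \subset S) &&
      (n <= #|A :|: [set x in open_run S L1] :|: [set x in open_run S L2]|)%N) <=
  p ^+ n * (1 + (n - #|A|)%:R * (1 - p)).
Proof.
have q_ge0 : 0 <= 1 - p by rewrite subr_ge0.
have setU_nil (B : {set V}) : B :|: [set x in [::]] = B.
  by apply/setP => x; rewrite !inE orbF.
have one_run (B C : {set V}) : [disjoint B & C] ->
  site_prob p (fun S => [&& B \subset S, [disjoint C & S]
                          & (n <= #|B :|: [set x in open_run S L2]|)%N]) <=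
  p ^+ n * (1 - p) ^+ #|C| := @site_prob_one_run n L2 B C.
have base (B : {set V}) :
  site_prob p (fun S => (B \subset S) &&
                          (n <= #|B :|: [set x in open_run S L2]|)%N) <= p ^+ n.
  apply: le_trans (le_trans (one_run B set0 _) _); last by rewrite cards0 mulr1.
    by apply: site_prob_le => S /andP[-> ->]; rewrite -setI_eq0 set0I eqxx.
  by rewrite -setI_eq0 setI0.
elim: L1 A => [|a L IHL] A.
  rewrite /= setU_nil; apply: le_trans (base A) _.
  by rewrite ler_peMr ?exprn_ge0 // lerDl mulr_ge0.
have [nA|An] := leqP n #|A|.
  apply: (@le_trans _ _ (p ^+ #|A|)).
    by rewrite -site_prob_subset; apply: site_prob_le => S /andP[].
  have/eqP-> : (n - #|A|)%N == 0 by rewrite subn_eq0.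
  by rewrite mul0r addr0 mulr1 ler_wiXn2l.
have [aA|aA] := boolP (a \in A).
  apply: le_trans (IHL A); apply: site_prob_le => S /andP[AS /=].
  rewrite AS (subsetP AS _ aA) => /leq_trans-> //; apply/subset_leq_card/subsetP.
  move=> x; rewrite !inE -!orbA => /or4P[->//|/eqP->|->|->]; by rewrite ?aA ?orbT.
rewrite (site_prob_split _ (fun S => a \in S)).
(* One of the n - #|A| summands is split off for the event that [a] is closed. *)
have -> : p ^+ n * (1 + (n - #|A|)%:R * (1 - p)) =
  p ^+ n * (1 + (n - #|a |: A|)%:R * (1 - p)) + p ^+ n * (1 - p) ^+ #|[set a]|.
  rewrite cards1 cardsU1 aA add1n expr1.
  by rewrite -(subnSK An) -natr1; ring.
apply: lerD.
  apply: le_trans (IHL (a |: A)); apply: site_prob_le => S /andP[/andP[AS]] /=.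
  move=> + aS; rewrite aS subUset sub1set aS AS => /leq_trans-> //.
  apply/subset_leq_card/subsetP => x; rewrite !inE.
  by rewrite -!orbA orbCA.
apply: le_trans (one_run A [set a] _); last first.
  by rewrite disjoint_sym disjoints1.
apply: site_prob_le => S /andP[aS /andP[AS]] /=.
by rewrite (negPf aS) setU_nil disjoints1 aS AS.
Qed.
End Site.

(** * Non-backtracking walks and the norm of the Hashimoto matrix *)

Section Walks.
Variables (V : finType) (e : rel V).

(** The diagonal case [nb_succ v v] excludes only a loop, so in a loopless digraph it is the whole
    out-neighbourhood of a root [v]. *)
Definition nb_succ (u w : V) : {set V} := [set z | e w z && (z != u)].

Definition nb_degree : nat :=
  \max_(a : edge e) #|nb_succ (edge_src a) (edge_tgt a)|.

Lemma card_nb_succ (u w : V) : e u w -> (#|nb_succ u w| <= nb_degree)%N.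
Proof.
move=> uw; pose a : edge e := exist _ (u, w) uw.
exact: (leq_bigmax a).
Qed.

(** A column sum counts the edges that may follow a given edge. They share their source, so their
    targets determine them and range over the corresponding [nb_succ]. *)
Lemma norm1_hashimoto (R : realType) :
  norm1_mx (hashimoto R e) = nb_degree%:R.
Proof.
have norm_ind (b c : bool) : `|b%:R * (1 - c%:R)| = (b && ~~ c)%:R :> R.
  by case: b; case: c; rewrite /= ?subrr ?subr0 ?mul0r ?mul1r ?normr0 ?normr1.
rewrite /norm1_mx /nb_degree.
have natrM_max : {morph (fun n : nat => n%:R : R) : x y / maxn x y >-> Num.max x y}.
  by move=> x y; rewrite -natr_max.
rewrite (big_morph _ natrM_max (mulr0n 1)).
rewrite [RHS](reindex (@enum_val _ (mem (edge e)))) /=; last first.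
  exact: onW_bij (enum_val_bij _).
apply: eq_bigr => i _; set a := enum_val i.
transitivity (\sum_(b : edge e)
    ((edge_tgt a == edge_src b) && (edge_tgt b != edge_src a))%:R : R).
  rewrite [RHS](reindex (@enum_val _ (mem (edge e)))) /=; last first.
    exact: onW_bij (enum_val_bij _).
  by apply: eq_bigr => j _; rewrite mxE; apply: norm_ind.
rewrite -(natr_sum R (index_enum _) xpredT
  (fun b => (edge_tgt a == edge_src b) && (edge_tgt b != edge_src a) : nat)).
congr (_%:R).
rewrite -big_mkcond sum1_card /=.
pose tgt : edge e -> V := @edge_tgt V e.
rewrite -(card_in_image (f := tgt)); last first.
  move=> [[b1 b2] bb] [[c1 c2] cc]; rewrite !unfold_in /tgt /edge_tgt /edge_src /=.
  move=> /andP[/eqP b1E _] /andP[/eqP c1E _] /= b2E.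
  by apply: val_inj; rewrite /= -b1E -c1E b2E.
apply: eq_card => z; rewrite !inE; apply/imageP/andP => [[b]|[az zs]].
  rewrite unfold_in => /andP[/eqP ab ba ->]; split=> //.
  by rewrite ab; exact: (valP b).
exists (exist _ (edge_tgt a, z) az : edge e) => //.
by rewrite unfold_in /edge_tgt /edge_src /= eqxx.
Qed.

Fixpoint nb_walks (k : nat) (u w : V) : seq (seq V) :=
  [::] :: if k is k'.+1 then
    [seq z :: s | z <- enum (nb_succ u w), s <- nb_walks k' w z] else [::].

(** A self-avoiding walk that misses [u] never returns to the vertex just left. After one step [w]
    takes over the role of [u]. *)
Lemma mem_nb_walks (k : nat) (u w : V) (s : seq V) :
  path e w s -> u \notin s -> uniq (w :: s) -> (size s <= k)%N ->
  s \in nb_walks k u w.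
Proof.
elim: k u w s => [|k IHk] u w [|z s] //=; rewrite inE.
move=> /andP[wz zs]; rewrite inE negb_or => /andP[uz us] /andP[ws us'] sk.
rewrite inE /=; apply/allpairsPdep; exists z, s; split=> //.
  by rewrite mem_enum inE wz eq_sym.
apply: IHk => //.
by move: ws; rewrite negb_or => /andP[].
Qed.

(** With h = [nb_degree], the bound is the fixed point of the one-step recursion: 1 + p h / (1 - p
    h) = 1 / (1 - p h). *)
Lemma nb_walks_weight (R : realFieldType) (p : R) (k : nat) (u w : V) :
  0 <= p -> p * nb_degree%:R < 1 -> e u w ->
  \sum_(s <- nb_walks k u w) p ^+ size s <= 1 / (1 - p * nb_degree%:R).
Proof.
move=> p0 pd; have D_gt0 : 0 < 1 - p * nb_degree%:R by rewrite subr_gt0.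
elim: k u w => [|k IHk] u w uw.
  rewrite /= big_seq1 expr0 ler_pdivlMr // mul1r lerBlDr lerDl.
  by rewrite mulr_ge0.
rewrite /= big_cons big_allpairs_dep expr0 big_enum /=.
set D := 1 - _ in D_gt0 IHk *.
have step z : z \in nb_succ u w ->
    \sum_(s <- nb_walks k w z) p ^+ (size (z :: s)) <= p * (1 / D).
  rewrite inE => /andP[wz _]; under eq_bigr do rewrite exprS.
  by rewrite -big_distrr /= ler_wpM2l // IHk.
apply: (@le_trans _ _ (1 + \sum_(z in nb_succ u w) p * (1 / D))).
  by rewrite lerD2l; apply: ler_sum.
rewrite sumr_const -mulr_natr.
apply: (@le_trans _ _ (1 + p * (1 / D) * nb_degree%:R)).
  have pD_ge0 : 0 <= p * (1 / D) by rewrite mulr_ge0 // divr_ge0 // ltW.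
  by rewrite lerD2l; apply: ler_wpM2l => //; rewrite ler_nat card_nb_succ.
by rewrite le_eqVlt; apply/orP; left; apply/eqP; rewrite /D; field; rewrite gt_eqF.
Qed.

(* The non-backtracking continuation of [u -> w]; it is canonical only when
   every [nb_succ] has at most one element. *)
Fixpoint nb_ray (k : nat) (u w : V) : seq V :=
  if k is k'.+1 then
    if [pick z in nb_succ u w] is Some z then z :: nb_ray k' w z else [::]
  else [::].

(** Each step has at most one continuation, so [pick] can only return the vertex the walk takes. *)
Lemma prefix_nb_ray (k : nat) (u w : V) (s : seq V) :
  (nb_degree <= 1)%N -> e u w -> path e w s -> uniq (u :: w :: s) ->
  (size s <= k)%N -> prefix s (nb_ray k u w).
Proof.
move=> d1; elim: k u w s => [|k IHk] u w [|z s] //= uw; rewrite ?prefix0s //.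
move=> /andP[wz zs] /and3P[]; rewrite !inE !negb_or.
move=> /and3P[uw' uz us] /andP[wz' ws] /andP[zs' uniqs] sk.
have zN : z \in nb_succ u w by rewrite inE wz eq_sym.
case: pickP => [z' z'N|/(_ z)]; last by rewrite zN.
have /card_le1_eqP N1 := leq_trans (card_nb_succ uw) d1.
have <- : z = z' by exact: N1.
by rewrite prefix_cons eqxx IHk //= inE negb_or wz' ws zs'.
Qed.

Lemma connect_induced (S : {set V}) (v w : V) :
  v \in S -> connect (induced e S) v w ->
  exists s, [/\ path e v s, uniq (v :: s), all (mem S) (v :: s) & w = last v s].
Proof.
move=> vS /connectP[s0 s0P ->]; case/shortenP: s0P => s sP us _.
exists s; split=> //.
  by apply: sub_path sP => x y /and3P[].
rewrite /= vS /=; elim: s {us s0} v vS sP => //= x s IHs v vS.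
by move=> /andP[/and3P[_ xS _] /(IHs _ xS)->]; rewrite /= andbT.
Qed.

(** This makes [#|V|] enough depth for [nb_walks] and [nb_ray]. *)
Lemma size_uniq_walk (v : V) (s : seq V) : uniq (v :: s) -> (size s <= #|V|)%N.
Proof. by move=> /card_uniqP /= us; rewrite ltnW // -us max_card. Qed.

End Walks.

(** * The first-moment and two-ray bounds *)

Section Bound.
Variables (R : realType) (V : finType) (e : rel V) (p : R).
Hypotheses (e_irr : irreflexive e) (p_ge0 : 0 <= p) (p_le1 : p <= 1).
Hypothesis pd_lt1 : p * (nb_degree e)%:R < 1.

(** Counting [v] itself among the reached vertices turns [m.-1] into [m]. *)
Lemma out_root_card (m : nat) (v : V) (S : {set V}) : out_root e m v S ->
  v \in S /\ (m <= #|[set w | connect (induced e S) v w]|)%N.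
Proof.
case/andP=> vS mS; split=> //; case: m mS => // m /= mS.
rewrite (cardsD1 v) inE connect0 add1n ltnS; apply: leq_trans mS _.
by apply/subset_leq_card/subsetP => w; rewrite !inE.
Qed.

(** The exponent counts the vertices of [v :: s]. No earlier edge restricts the first step, so it
    has out-degree many choices; [nb_walks_weight] handles the rest. *)
Lemma root_walks_weight (k : nat) (v : V) :
  \sum_(s <- nb_walks e k.+1 v v) p ^+ (size s).+1 <=
  p * (1 + #|nb_succ e v v|%:R * (p / (1 - p * (nb_degree e)%:R))).
Proof.
under eq_bigr do rewrite exprS.
rewrite -big_distrr ler_wpM2l //= big_cons big_allpairs_dep expr0 big_enum /=.
rewrite lerD2l mulr_natl -sumr_const; apply: ler_sum => z.
rewrite inE => /andP[vz _]; under eq_bigr do rewrite exprS.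
rewrite -big_distrr ler_wpM2l //= -[leRHS]mul1r.
exact: nb_walks_weight.
Qed.

Lemma P_out_first_moment (m : nat) (v : V) :
  m%:R * P_out e p m v <=
  p * (1 + #|nb_succ e v v|%:R * (p / (1 - p * (nb_degree e)%:R))).
Proof.
apply: le_trans (root_walks_weight #|V| v).
set W := nb_walks e #|V|.+1 v v.
(* Requiring [uniq] makes the walk occupy exactly [(size s).+1] vertices, so its probability of
   being open is the matching power of [p]; other walks in [W] count zero. *)
pose openw s (S : {set V}) := uniq (v :: s) && ([set x in v :: s] \subset S).
apply: le_trans (@markov_card R V p p_ge0 p_le1 _
  (fun S => \sum_(s <- W) openw s S)%N m _) _.
  move=> S /out_root_card[vS /leq_trans-> //].
  rewrite -big_mkcond sum1_count -size_filter.
  rewrite -(size_map (last v)); apply: leq_trans (card_size _).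
  apply/subset_leq_card/subsetP => w; rewrite inE => vw.
  have [s [sP us /allP sS ->]] := connect_induced vS vw.
  apply/mapP; exists s => //; rewrite mem_filter /openw us /=; apply/andP; split.
    by apply/subsetP => x; rewrite inE; apply: sS.
  apply: mem_nb_walks => //; first by case/andP: us.
  by rewrite ltnW // ltnS (size_uniq_walk us).
under eq_bigr do rewrite natr_sum big_distrl /=.
rewrite exchange_big /=; apply: ler_sum => s _.
have [us|us] := boolP (uniq (v :: s)); last first.
  by rewrite big1 ?exprn_ge0 // => S _; rewrite /openw (negPf us) mul0r.
have <- : #|[set x in v :: s]| = (size s).+1 by rewrite cardsE (card_uniqP us).
rewrite -site_prob_subset // /site_prob [leRHS]big_mkcond.
apply: ler_sum => S _; rewrite /openw us /=.
by case: ifP; rewrite ?mul1r ?mul0r.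
Qed.

Lemma P_out_two_rays (m : nat) (v : V) :
  (0 < m)%N -> (nb_degree e <= 1)%N -> (#|nb_succ e v v| <= 2)%N ->
  P_out e p m v <= p ^+ m * (1 + m.-1%:R * (1 - p)).
Proof.
move=> m_gt0 d1 v2.
(* [a] and [b] may coincide, which covers out-degree below 2. *)
have [a [b vab]] : exists a b, nb_succ e v v \subset [set a; b].
  case: (posnP #|nb_succ e v v|) => [/eqP|].
    by rewrite cards_eq0 => /eqP->; exists v, v; apply: sub0set.
  rewrite card_gt0 => /set0Pn[a aN].
  move: v2; rewrite (cardsD1 a) aN ltnS.
  case: (set_0Vmem (nb_succ e v v :\ a)) => [N0 _|[b bN] N1].
    exists a, a; apply/subsetP => z zN; rewrite !inE orbb.
    apply/negPn/negP => za.
    by have := in_set0 z; rewrite -N0 in_setD1 za zN.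
  exists a, b; apply/subsetP => z zN; rewrite !inE.
  have [//|/= za] := eqVneq z a.
  by apply/eqP/(card_le1_eqP N1) => //; rewrite in_setD1 za.
pose L c := c :: nb_ray e #|V| v c.
have cA : #|[set v]| = 1%N by rewrite cards1.
rewrite -subn1 -cA.
apply: le_trans (site_prob_two_runs p_ge0 p_le1 m (L a) (L b) [set v]).
apply: site_prob_le => // S /out_root_card[vS mS].
rewrite sub1set vS; apply: leq_trans mS _; apply/subset_leq_card/subsetP => w.
rewrite inE => vw.
have [s [sP us /andP[_ sS] ->]] := connect_induced vS vw.
case: s sP us sS => [|z s]; first by rewrite !inE eqxx.
move=> /= /andP[vz zs] us zsS.
have zN : z \in nb_succ e v v.
  by rewrite inE vz; apply: contraTneq vz => ->; rewrite e_irr.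
(* An open self-avoiding walk starting with the edge from [v] to [c] is a prefix of the ray [L c],
   hence lies in its open run. *)
have run c : z = c -> last z s \in open_run S (L c).
  move=> <-; apply: (@open_run_prefix _ _ (z :: s)) => //; last exact: mem_last.
  rewrite prefix_cons eqxx prefix_nb_ray //.
  by apply: (@size_uniq_walk _ z); case/andP: us.
by move/subsetP/(_ _ zN): vab; rewrite !inE => /orP[]/eqP/run->; rewrite ?orbT.
Qed.

End Bound.

(** * Degree consequences of strong connectivity *)

Section Degree.
Variables (V : finType) (e : rel V).
Hypotheses (e_irr : irreflexive e) (e_conn : strongly_connected e).

Lemma in_edge (v w : V) : e v w -> exists u, e u v.
Proof.
move=> vw; have /connectP[s] := e_conn w v.
case: (lastP s) => [_ /= wv|s' u]; first by rewrite wv e_irr in vw.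
rewrite rcons_path last_rcons => /andP[_ lu] ->; by exists (last w s').
Qed.

(** For an edge from [u] into [v], every out-neighbour of [v] except possibly [u] is a
    non-backtracking successor. *)
Lemma out_degree_le (v : V) : (#|nb_succ e v v| <= (nb_degree e).+1)%N.
Proof.
have [->|/set0Pn[w]] := eqVneq (nb_succ e v v) set0; first by rewrite cards0.
rewrite inE => /andP[vw _]; have [u uv] := in_edge vw.
rewrite (cardsD1 u); apply: leq_add (leq_b1 _) _.
apply: leq_trans (card_nb_succ uv).
by apply/subset_leq_card/subsetP => z; rewrite !inE => /andP[-> /andP[->]].
Qed.

(** Any two consecutive edges return to their start, so the set of [v] and [w] is closed under
    out-edges, and everything is reachable from [v]. *)
Lemma nb_degree0_card (v w : V) : nb_degree e = 0%N -> e v w -> #|V| = 2%N.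
Proof.
move=> d0 vw.
have back x y z : e x y -> e y z -> z = x.
  move=> xy yz; have := card_nb_succ xy; rewrite d0 leqn0 cards_eq0.
  by move=> /eqP/setP/(_ z); rewrite !inE yz /= => /negbFE/eqP.
have [u uv] := in_edge vw; have wu := back _ _ _ uv vw; subst u.
have v_neq_w : v != w by apply: contraTneq vw => ->; rewrite e_irr.
rewrite -cardsT; have -> : [set: V] = [set v; w]; last by rewrite cards2 v_neq_w.
have closed z s : z \in [set v; w] -> path e z s -> last z s \in [set v; w].
  elim: s z => //= y s IHs z zT /andP[zy]; apply: IHs; move: zT zy.
  rewrite !inE => /orP[]/eqP->.
    by move/(back _ _ _ uv)->; rewrite eqxx orbT.
  by move/(back _ _ _ vw)->; rewrite eqxx.
apply/setP => x; rewrite in_setT; have /connectP[s vs ->] := e_conn v x.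
by rewrite closed // !inE eqxx.
Qed.

End Degree.

(** * Case analysis on the norm and the out-degree *)

Theorem theorem1 (R : realType) (V : finType) (e : rel V)
  (e_irr : irreflexive e) (e_conn : strongly_connected e)
  (V_neq2 : #|V| != 2%N)
  (p : R) (p_ge0 : 0 <= p) (p_le1 : p <= 1)
  (pH_lt1 : p * norm1_mx (hashimoto R e) < 1)
  (m : nat) (m_gt0 : (0 < m)%N) (v : V) :
  m%:R * P_out e p m v <= 1 / (1 - p * norm1_mx (hashimoto R e)).
Proof.
move: pH_lt1; rewrite norm1_hashimoto => pd_lt1.
have D_gt0 : 0 < 1 - p * (nb_degree e)%:R by rewrite subr_gt0.
have dv := out_degree_le e_irr e_conn v.
(* The second alternative is the first-moment bound compared with 1 / (1 - p h), cleared of its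
   denominator. *)
have [[d1 v2]|firstmoment] :
    (nb_degree e = 1%N /\ #|nb_succ e v v| = 2%N) \/
    p * (1 - p * (nb_degree e)%:R) + p ^+ 2 * #|nb_succ e v v|%:R <= 1.
- have [vd|dv'] := leqP #|nb_succ e v v| (nb_degree e).
    right; have : p ^+ 2 * #|nb_succ e v v|%:R <= p ^+ 2 * (nb_degree e)%:R.
      by rewrite ler_wpM2l ?exprn_ge0 // ler_nat.
    by move=> *; lra.
  have vE : #|nb_succ e v v| = (nb_degree e).+1 by apply/eqP; rewrite eqn_leq dv.
  case dE: (nb_degree e) vE pd_lt1 => [|[|d]] vE pd_lt1.
  + have /set0Pn[w] : nb_succ e v v != set0 by rewrite -card_gt0 vE.
    rewrite inE => /andP[vw _].
    by rewrite (nb_degree0_card e_irr e_conn dE vw) in V_neq2.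
  + by left.
  (* With out-degree h + 1 the left side equals p + p^2, and p h < 1 with h >= 2 gives p < 1/2. *)
  + right; rewrite vE -natr1.
    have : p * 2 <= p * d.+2%:R by rewrite ler_wpM2l // ler_nat.
    by move=> *; nra.
- rewrite ler_pdivlMr // d1 mulr1.
  apply: le_trans (two_run_tail_le1 m p_ge0 p_le1).
  rewrite mulrAC; apply: ler_wpM2l; first by rewrite mulr_ge0 ?subr_ge0.
  by apply: P_out_two_rays; rewrite ?d1 ?v2.
apply: le_trans (P_out_first_moment p_ge0 p_le1 pd_lt1 m v) _.
rewrite ler_pdivlMr //; apply: le_trans firstmoment.
rewrite le_eqVlt; apply/orP; left; apply/eqP; field; exact: lt0r_neq0.
Qed.
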